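(* Let $X$ be a Hadamard space with linear dual space $X^{\lozenge}$ and let $p\in X$. Let $T:X\multimap X^{\lozenge}$ be a maximal monotone operator such that $X\times\mathrm{Range}(T)$ has the $\mathcal F_l$-property. Then $\Phi^p_T\in\Gamma_p^{\lozenge}(X)$. In particular, if $X$ is a flat Hadamard space and $T:X\multimap X^{\lozenge}$ is maximal monotone, then $\Phi^p_T\in\Gamma_p^{\lozenge}(X)$.
   Context: A Hadamard space is a (nonempty) complete $\mathrm{CAT}(0)$ space $(X,d)$. For $x,y\in X$ and $t\in[0,1]$, $(1-t)x\oplus ty$ denotes the point $c(t)$ of the unique constant-speed geodesic $c:[0,1]\to X$ from $x$ to $y$. $X$ is flat if $d(z,(1-t)x\oplus ty)^2=(1-t)d(z,x)^2+td(z,y)^2-t(1-t)d(x,y)^2$ for all $x,y,z\in X$, $t\in[0,1]$. Quasilinearization: for $x,y,u,v\in X$, $\langle\overrightarrow{xy},\overrightarrow{uv}\rangle:=\frac12\big(d(x,v)^2+d(y,u)^2-d(x,u)^2-d(y,v)^2\big)$. Dual spaces: for $t\in\mathbb R$, $a,b\in X$, $[t\overrightarrow{ab}]$ is the class of $(t,a,b)\in\mathbb R\times X^2$ under the relation $(t,a,b)\sim(s,c,d)$ iff $t\langle\overrightarrow{ab},\overrightarrow{xy}\rangle=s\langle\overrightarrow{cd},\overrightarrow{xy}\rangle$ for all $x,y\in X$; it is identified with the function $\overrightarrow{xy}\mapsto t\langle\overrightarrow{ab},\overrightarrow{xy}\rangle$ on $X^2$. $X^*$ is the set of all such classes, and the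 linear dual $X^{\lozenge}$ is the real vector space of all finite linear combinations $\sum_i\alpha_i x_i^*$ ($\alpha_i\in\mathbb R$, $x_i^*\in X^*$), acting on $X^2$ by $\langle\sum_i\alpha_ix_i^*,\overrightarrow{xy}\rangle=\sum_i\alpha_i\langle x_i^*,\overrightarrow{xy}\rangle$ (elements with the same action are equal). $X^{\lozenge}$ carries the norm $\|x^{\lozenge}\|_{\lozenge}=\sup\Big\{\frac{|\langle x^{\lozenge},\overrightarrow{ab}\rangle-\langle x^{\lozenge},\overrightarrow{cd}\rangle|}{d(a,b)+d(c,d)}: a,b,c,d\in X,\ (a,c)\ne(b,d)\Big\}$, and $X\times X^{\lozenge}$ the product topology. For $M\subseteq X\times X^{\lozenge}$, $\mathrm{Dom}(M)$ and $\mathrm{Range}(M)$ are the projections of $M$ to $X$ and $X^{\lozenge}$. $M$ has the $\mathcal F_l$-property if $\langle x^{\lozenge},\overrightarrow{p((1-\lambda)x\oplus\lambda y)}\rangle\le(1-\lambda)\langle x^{\lozenge},\overrightarrow{px}\rangle+\lambda\langle x^{\lozenge},\overrightarrow{py}\rangle$ for all $\lambda\in[0,1]$, $x^{\lozenge}\in\mathrm{Range}(M)$, $x,y\in\mathrm{Dom}(M)$ (this does not depend on the choice of $p\in X$). For $h:X\times X^{\lozenge}\to[-\infty,\infty]$: $h$ is proper if it never takes the value $-\infty$ and $h\not\equiv\infty$; l.s.c. if its epigraph is closed; convex if $h((1-\lambda)x\oplus\lambda y,(1-\lambda)x^{\lozenge}+\lambda y^{\lozenge})\le(1-\lambda)h(x,x^{\lozenge})+\lambda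 h(y,y^{\lozenge})$ for all $(x,x^{\lozenge}),(y,y^{\lozenge})$ and $\lambda\in[0,1]$. $\Gamma(X\times X^{\lozenge})$ is the set of proper, l.s.c., convex $h:X\times X^{\lozenge}\to[-\infty,\infty]$. Fix $p\in X$. $\pi_p(x,x^{\lozenge}):=\langle x^{\lozenge},\overrightarrow{px}\rangle$ on $X\times X^{\lozenge}$; $r(x,x^{\lozenge}):=(x^{\lozenge},x)$. The indicator $\iota_A$ equals $0$ on $A$ and $\infty$ off $A$. $\{h\le\pi_p\}:=\{(x,x^{\lozenge}):h(x,x^{\lozenge})\le\pi_p(x,x^{\lozenge})\}$. The $p$-Fenchel conjugate $h_p^{\lozenge}:X^{\lozenge}\times X\to[-\infty,\infty]$ is $$h_p^{\lozenge}(x^{\lozenge},x)=\sup_{(y,y^{\lozenge})\in X\times X^{\lozenge}}\{\langle x^{\lozenge},\overrightarrow{py}\rangle+\langle y^{\lozenge},\overrightarrow{px}\rangle-h(y,y^{\lozenge})\}.$$ $\Gamma_p^{\lozenge}(X):=\{h\in\Gamma(X\times X^{\lozenge}): h=(h+\iota_{\{h\le\pi_p\}})_p^{\lozenge}\circ r\text{ on }X\times X^{\lozenge}\}$. For a set-valued operator $T:X\multimap X^{\lozenge}$ (a map assigning to each $x\in X$ a possibly empty subset $T(x)\subseteq X^{\lozenge}$), $\mathrm{gra}(T)=\{(x,x^{\lozenge}):x^{\lozenge}\in T(x)\}$ and $\mathrm{Range}(T)=\mathrm{Range}(\mathrm{gra}(T))$. $T$ is monotone if $\langle x^{\lozenge}-y^{\lozenge},\overrightarrow{yx}\rangle\ge0$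 for all $(x,x^{\lozenge}),(y,y^{\lozenge})\in\mathrm{gra}(T)$; it is maximal monotone if it is monotone and no monotone operator has a graph properly containing $\mathrm{gra}(T)$. The $p$-Fitzpatrick transform of $T$ is $\Phi^p_T:X\times X^{\lozenge}\to[-\infty,\infty]$, $$\Phi^p_T(x,x^{\lozenge})=\sup_{(y,y^{\lozenge})\in\mathrm{gra}(T)}\{\langle x^{\lozenge},\overrightarrow{py}\rangle-\langle y^{\lozenge},\overrightarrow{xy}\rangle\}.$$ *)

(* Defs.v *)
From HB Require Import structures.
From mathcomp Require Import all_boot all_order all_algebra.
From mathcomp Require Import all_classical all_reals.
From mathcomp Require Import ereal topology normedtype.
From mathcomp Require Import ring lra.

Set Implicit Arguments.
Unset Strict Implicit.
Unset Printing Implicit Defensive.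

Import Order.TTheory GRing.Theory Num.Theory.
Import numFieldNormedType.Exports.

Local Open Scope classical_set_scope.
Local Open Scope ring_scope.

Section Hadamard.
Context {R : realType} {X : metricType R}.
Implicit Types (x y z u v : X) (s t : R).

(* Only the restriction of c to [0, 1] matters. *)
Definition geodesic (c : R -> X) x y :=
  [/\ c 0 = x, c 1 = y &
      forall s t, 0 <= s <= 1 -> 0 <= t <= 1 ->
        mdist (c s) (c t) = `|s - t| * mdist x y].

Definition plane_dist (a b : 'rV[R]_2) : R :=
  Num.sqrt (\sum_i (a 0 i - b 0 i) ^+ 2).

(* The comparison inequality for points on the sides [x, y] and [x, z] of a
   geodesic triangle; as x, y, z are arbitrary and the reverse of a geodesic is
   a geodesic, this covers every pair of sides. The existence of the third side
   [y, z] is part of geodesic_space. *)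
Definition triangle_comparison :=
  forall x y z (c c' : R -> X) (x' y' z' : 'rV[R]_2),
    geodesic c x y -> geodesic c' x z ->
    plane_dist x' y' = mdist x y -> plane_dist x' z' = mdist x z ->
    plane_dist y' z' = mdist y z ->
    forall s t, 0 <= s <= 1 -> 0 <= t <= 1 ->
      mdist (c s) (c' t) <=
        plane_dist ((1 - s) *: x' + s *: y') ((1 - t) *: x' + t *: z').

Definition geodesic_space := forall x y, exists c, geodesic c x y.

Definition CAT0 := geodesic_space /\ triangle_comparison.

Definition complete_space :=
  forall F : set_system X, ProperFilter F -> cauchy F -> exists x, F --> x.

Definition hadamard := [/\ [set: X] !=set0, complete_space & CAT0].

(* (1 - t) x (+) t y. The default value x is irrelevant in a CAT(0) space, where
   for t in [0, 1] the set below is a singleton. *)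
Definition geopt x y t : X :=
  xget x [set z | exists2 c, geodesic c x y & z = c t].

Definition flat :=
  forall x y z t, 0 <= t <= 1 ->
    mdist z (geopt x y t) ^+ 2 =
      (1 - t) * mdist z x ^+ 2 + t * mdist z y ^+ 2
      - t * (1 - t) * mdist x y ^+ 2.

Definition qlin x y u v : R :=
  2^-1 * (mdist x v ^+ 2 + mdist y u ^+ 2 - mdist x u ^+ 2 - mdist y v ^+ 2).

(* The class [t ab], identified with its action on X^2. *)
Definition bound_vec t (a b : X) : X * X -> R^o :=
  fun xy => t * qlin a b xy.1 xy.2.

Definition dual_space : set (X * X -> R^o) :=
  [set f | exists t a b, f = bound_vec t a b].

Definition linear_dual : set (X * X -> R^o) :=
  [set f | exists2 l : seq (R * (X * X -> R^o)),
     (forall c, c \in l -> dual_space c.2) & f = \sum_(c <- l) c.1 *: c.2].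

Definition linear_dual_pred : {pred X * X -> R^o} := mem linear_dual.

Lemma linear_dual_submod_closed : submod_closed linear_dual_pred.
Proof.
split=> [|k u v].
  by rewrite inE; exists [::] => //; rewrite big_nil.
rewrite !inE => -[l hl ->] [m hm ->].
exists ([seq (k * c.1, c.2) | c <- l] ++ m).
  move=> c; rewrite mem_cat => /orP[/mapP[d /hl dl ->]|/hm] //.
rewrite big_cat big_map scaler_sumr; congr (_ + _).
by apply: eq_bigr => c _; rewrite scalerA.
Qed.

End Hadamard.

Arguments hadamard {R} X.
Arguments flat {R} X.
Arguments linear_dual {R} X.
Arguments linear_dual_pred {R} X.

HB.instance Definition _ (R : realType) (X : metricType R) :=
  GRing.isSubmodClosed.Build R (X * X -> R^o)
    (linear_dual_pred X) linear_dual_submod_closed.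

(* X^<>: functions are equal when they agree pointwise, hence elements of ldual
   with the same action are equal. *)
Record ldual (R : realType) (X : metricType R) := LDual {
  ldual_fun : X * X -> R^o;
  _ : ldual_fun \in linear_dual_pred X }.

HB.instance Definition _ (R : realType) (X : metricType R) :=
  [isSub for @ldual_fun R X].
HB.instance Definition _ (R : realType) (X : metricType R) :=
  [Choice of ldual X by <:].
HB.instance Definition _ (R : realType) (X : metricType R) :=
  [SubChoice_isSubLmodule of ldual X by <:].

Section LinearDual.
Context {R : realType} {X : metricType R}.
Implicit Types (f g : ldual X) (x y : X).

Definition pairing f x y : R := ldual_fun f (x, y).

Lemma pairing_chasles f x y z : pairing f x z = pairing f x y + pairing f y z.
Proof.
case: f => f; rewrite /pairing /= inE => -[l hl ->].
rewrite !fct_sumE -big_split; apply: eq_big_seq => c /hl[t [a [b cE]]].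
rewrite -[LHS]/(c.1 * c.2 (x, z)) -[RHS]/(c.1 * c.2 (x, y) + c.1 * c.2 (y, z)).
by rewrite cE /bound_vec /qlin /=; ring.
Qed.

(* Finite when X is a Hadamard space. If X is a singleton, then so is ldual X,
   and the supremum is over the empty set. *)
Definition ldual_norm f : \bar R :=
  ereal_sup [set r : \bar R | exists a b c d : X, (a, c) <> (b, d) /\
    r = (`|pairing f a b - pairing f c d| / (mdist a b + mdist c d))%:E].

Definition ldual_ball f (e : R) : set (ldual X) :=
  [set g | (ldual_norm (f - g)%R < e%:E)%E].

Lemma ldual_norm0 : (ldual_norm 0%R <= 0)%E.
Proof.
apply: ge_ereal_sup => _ [a [b [c [d [_ ->]]]]].
by rewrite /pairing subrr normr0 mul0r.
Qed.

Lemma ldual_normN f : ldual_norm (- f)%R = ldual_norm f.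
Proof.
have pN x y : pairing (- f) x y = - pairing f x y by [].
rewrite /ldual_norm; congr ereal_sup; apply/seteqP; split=> r
  [a [b [c [d [h ->]]]]]; exists a, b, c, d; split=> //;
  by rewrite !pN -opprD normrN.
Qed.

Lemma ler_ldual_normD f g :
  (ldual_norm (f + g)%R <= ldual_norm f + ldual_norm g)%E.
Proof.
apply: ge_ereal_sup => _ [a [b [c [d [h ->]]]]].
pose q (k : ldual X) : R :=
  `|pairing k a b - pairing k c d| / (mdist a b + mdist c d).
have qle k : ((q k)%:E <= ldual_norm k)%E.
  by apply: ereal_sup_ubound; exists a, b, c, d.
apply: le_trans (leeD (qle f) (qle g)).
rewrite -EFinD lee_fin /q -mulrDl ler_wpM2r ?invr_ge0 ?addr_ge0 ?mdist_ge0//.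
have pD x y : pairing (f + g) x y = pairing f x y + pairing g x y by [].
by rewrite !pD opprD addrACA ler_normD.
Qed.

Let ball_center f e : 0 < e -> ldual_ball f e f.
Proof.
by move=> e0; rewrite /ldual_ball /= subrr (le_lt_trans ldual_norm0) ?lte_fin.
Qed.

Let ball_sym f g e : ldual_ball f e g -> ldual_ball g e f.
Proof. by rewrite /ldual_ball /= -ldual_normN opprB. Qed.

Let ball_triangle f g h e1 e2 :
  ldual_ball f e1 g -> ldual_ball g e2 h -> ldual_ball f (e1 + e2) h.
Proof.
rewrite /ldual_ball /= => fg gh; rewrite -(subrKA g) EFinD.
exact: le_lt_trans (ler_ldual_normD _ _) (lteD fg gh).
Qed.

Let ent : set_system (ldual X * ldual X) := entourage_ ldual_ball.

HB.instance Definition _ := hasNbhs.Build (ldual X) (nbhs_ ent).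

HB.instance Definition _ := @Nbhs_isPseudoMetric.Build R (ldual X)
  ent erefl ldual_ball ball_center ball_sym ball_triangle erefl.

End LinearDual.

Section Gamma.
Context {R : realType} {X : metricType R}.
Implicit Types (x y p : X) (f g : ldual X) (M : set (X * ldual X)).
Implicit Types (h : X * ldual X -> \bar R) (T S : X -> set (ldual X)).

Definition Dom M : set X := fst @` M.
Definition Range M : set (ldual X) := snd @` M.

Definition Fl_property p M :=
  forall (l : R) f x y, 0 <= l <= 1 -> Range M f -> Dom M x -> Dom M y ->
    pairing f p (geopt x y l) <= (1 - l) * pairing f p x + l * pairing f p y.

Lemma Fl_property_basepoint p q M : Fl_property p M -> Fl_property q M.
Proof.
move=> H l f x y l01 Mf Mx My; have := H l f x y l01 Mf Mx My.
have E z : pairing f q z = pairing f q p + pairing f p z.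
  exact: pairing_chasles.
rewrite (E x) (E y) (E (geopt x y l)); lra.
Qed.

Definition proper h := (forall z, h z <> -oo%E) /\ (exists z, h z <> +oo%E).

Definition epigraph h : set ((X * ldual X) * R) :=
  [set w | (h w.1 <= w.2%:E)%E].

Definition lsc h := closed (epigraph h).

Definition convex h := forall x y f g (l : R), 0 <= l <= 1 ->
  (h (geopt x y l, (1 - l) *: f + l *: g)%R
     <= (1 - l)%:E * h (x, f) + l%:E * h (y, g))%E.

Definition Gamma : set (X * ldual X -> \bar R) :=
  [set h | [/\ proper h, lsc h & convex h]].

Definition pi_ p : X * ldual X -> \bar R := fun z => (pairing z.2 p z.1)%:E.

Definition r_swap (z : X * ldual X) : ldual X * X := (z.2, z.1).

Definition iota_ (A : set (X * ldual X)) : X * ldual X -> \bar R :=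
  fun z => if z \in A then 0%E else +oo%E.

Definition fenchel_conj p h : ldual X * X -> \bar R := fun z =>
  ereal_sup
    (range (fun w => (pairing z.1 p w.1 + pairing w.2 p z.2)%:E - h w)%E).

Definition le_pi p h : set (X * ldual X) := [set z | (h z <= pi_ p z)%E].

Definition Gamma_dual p : set (X * ldual X -> \bar R) :=
  [set h | Gamma h /\
     h = fenchel_conj p (fun z => h z + iota_ (le_pi p h) z)%E \o r_swap].

Definition gra T : set (X * ldual X) := [set z | T z.1 z.2].

Definition monotone T := forall z w, gra T z -> gra T w ->
  0 <= pairing (z.2 - w.2) w.1 z.1.

Definition maximal_monotone T :=
  monotone T /\ ~ exists2 S, monotone S & gra T `<` gra S.

Definition fitzpatrick p T : X * ldual X -> \bar R := fun z =>
  ereal_sup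
    [set (pairing z.2 p w.1 - pairing w.2 z.1 w.1)%:E | w in gra T].

End Gamma.

(* Main.v *)
(* On gra T one has Phi_T = pi_p by monotonicity, and {Phi_T <= pi_p} is the set
   of pairs monotonically related to gra T, which is gra T by maximality. Hence
   the conjugate of Phi_T + iota_{Phi_T <= pi_p} is a supremum over gra T only,
   where it has the same terms as Phi_T, since for (y, g) in gra T
   <f, py> - <g, xy> = <f, py> + <g, px> - <g, py>.
   These terms are continuous in (x, f), and convex by the F_l-property; the
   latter always holds in a flat space, since there the quadratic corrections
   in the squared distances defining <ab, px> cancel. *)
Require Import Defs.
From mathcomp Require Import all_boot all_order all_algebra.
From mathcomp Require Import all_classical all_reals.
From mathcomp Require Import ereal topology normedtype.
From mathcomp Require Import ring lra.

Import Order.TTheory GRing.Theory Num.Theory.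
Import numFieldNormedType.Exports.

Local Open Scope classical_set_scope.
Local Open Scope ring_scope.

(** * Continuity of the pairing, and its affinity along geodesics of a flat space *)

Section LinearDualTheory.
Context {R : realType} {X : metricType R}.
Implicit Types (p x y z : X) (f g : ldual X).

(** Coefficients are absorbed into the scalars of the bound vectors, so every element of the linear
    dual arises from 0 by adding single bound vectors. *)
Lemma linear_dual_ind (P : (X * X -> R^o) -> Prop) :
  P 0 -> (forall t a b h, P h -> P (bound_vec t a b + h)) ->
  forall f, P (ldual_fun f).
Proof.
move=> P0 PD [f /=]; rewrite inE => -[l hl ->].
elim: l hl => [|c l IH] hl; first by rewrite big_nil.
rewrite big_cons; have /hl [t [a [b ->]]] : c \in c :: l by rewrite mem_head.
have -> : c.1 *: bound_vec t a b = bound_vec (c.1 * t) a b.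
  by apply/funext => xy; rewrite /bound_vec -mulrA.
by apply: PD; apply: IH => d dl; apply: hl; rewrite inE dl orbT.
Qed.

Lemma pairingxx f x : pairing f x x = 0.
Proof. by have := pairing_chasles f x x x; lra. Qed.

Lemma pairingB f g x y : pairing (f - g) x y = pairing f x y - pairing g x y.
Proof. by []. Qed.

Lemma pairing_conv (l : R) f g x y :
  pairing ((1 - l) *: f + l *: g) x y
  = (1 - l) * pairing f x y + l * pairing g x y.
Proof. by []. Qed.

Lemma mdist_continuous x : continuous (mdist x : X -> R).
Proof.
move=> y; apply/cvgrPdist_lt => e e0; apply/nbhs_ballP; exists e => // z.
rewrite ballEmdist /= => yz.
have := metric_triangle x z y; have := metric_triangle x y z.
by rewrite (metric_sym z y) ltr_norml; lra.
Qed.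

Lemma pairing_continuousl f y : continuous (fun x => pairing f x y : R).
Proof.
apply: (linear_dual_ind (fun h => continuous (fun x => h (x, y) : R))).
  by move=> x; exact: cvg_cst.
move=> t a b h hc x; apply: (@cvgD _ R^o); last exact: hc.
rewrite /bound_vec /qlin /=.
have sq u : mdist u z ^+ 2 @[z --> x] --> mdist u x ^+ 2.
  by rewrite expr2; under eq_fun do rewrite expr2;
    apply: cvgM; exact: mdist_continuous.
apply: cvgMl_tmp; apply: cvgMl_tmp.
by apply: cvgB; [apply: cvgB; [apply: cvgD; [exact: cvg_cst|]|]|exact: cvg_cst].
Qed.

Lemma pairing_continuous x y : continuous (fun f => pairing f x y : R).
Proof.
have [->|xy] := eqVneq x y.
  have -> : (fun f => pairing f y y : R) = cst 0.
    by apply/funext => f; exact: pairingxx.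
  exact: cst_continuous.
have d0 : 0 < mdist x y by rewrite mdist_gt0.
(* nbhsf is found by the inference of Filter (nbhs f), which fails otherwise. *)
move=> f; have nbhsf := nbhs_filter f.
apply/(@cvgrPdist_lt _ R^o _ (nbhs f)) => e e0.
apply/nbhs_ballP.
exists (e / mdist x y) => /=; first exact: divr_gt0.
move=> g; rewrite /ball /= /ldual_ball /= => fg.
(* The quotient of the norm at [(a, b, c, d) = (x, y, x, x)] shows that evaluation at [(x, y)] is
   Lipschitz in [f] with constant [mdist x y]. *)
have : ((`|pairing (f - g) x y - pairing (f - g) x x|
          / (mdist x y + mdist x x))%:E <= ldual_norm (f - g)%R)%E.
  apply: ereal_sup_ubound; exists x, y, x, x; split; last by [].
  by case=> xE; case/eqP: xy.
move=> /le_lt_trans/(_ fg).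
by rewrite lte_fin pairingxx subr0 mdistxx addr0 ltr_pM2r ?invr_gt0.
Qed.

Lemma flat_pairing_geopt f p x y (l : R) : flat X -> 0 <= l <= 1 ->
  pairing f p (geopt x y l) = (1 - l) * pairing f p x + l * pairing f p y.
Proof.
move=> X_flat l01; apply: (linear_dual_ind (fun h =>
  h (p, geopt x y l) = (1 - l) * h (p, x) + l * h (p, y))).
  by rewrite -[LHS]/0 -[RHS]/((1 - l) * 0 + l * 0) !mulr0 addr0.
move=> t a b h hE.
have fD u : (bound_vec t a b + h) (p, u) = t * qlin a b p u + h (p, u) by [].
rewrite !fD hE /qlin (X_flat x y a l l01) (X_flat x y b l l01).
ring.
Qed.

End LinearDualTheory.

(** * The Fitzpatrick transform of a maximal monotone operator *)

Section Fitzpatrick.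
Context {R : realType} {X : metricType R}.
Variable p : X.
Implicit Types (T : X -> set (ldual X)) (z w : X * ldual X).

Lemma maximal_monotone_mem T z : maximal_monotone T ->
  (forall w, gra T w -> 0 <= pairing (z.2 - w.2) w.1 z.1) -> gra T z.
Proof.
move=> [Tmono Tmax] zT; apply: contrapT => nTz; apply: Tmax.
(* The competitor is [T] with the single pair [z] adjoined to its graph. *)
exists (fun x => [set f | T x f \/ (x, f) = z]) => [v w|].
  (* Exchanging the two pairs flips both the functional and the vector, so the two signs cancel. *)
  have sym u : pairing (z.2 - u.2) u.1 z.1 = pairing (u.2 - z.2) z.1 u.1.
    have := pairing_chasles (z.2 - u.2) u.1 z.1 u.1.
    by rewrite pairingxx !pairingB; lra.
  have graS u : T u.1 u.2 \/ (u.1, u.2) = z -> gra T u \/ u = z by case: u.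
  move=> /graS [Tv|->] /graS [Tw|->].
  - exact: Tmono.
  - by rewrite -sym; exact: zT.
  - exact: zT.
  - by rewrite pairingxx.
split=> [[x f]|sub]; first by left.
by apply/nTz/sub; rewrite /gra /=; right; case: (z).
Qed.

(** Every pair is vacuously monotonically related to an empty graph, so maximality would put
    [(p, 0)] in it. *)
Lemma maximal_monotone_nonempty T : maximal_monotone T -> gra T !=set0.
Proof.
move=> Tmax; apply: contrapT => /set0P/negP/negPn/eqP T0.
suff : gra T (p, 0) by rewrite T0.
by apply: maximal_monotone_mem => // w; rewrite T0.
Qed.

Lemma le_fitzpatrick T z w : gra T w ->
  ((pairing z.2 p w.1 - pairing w.2 z.1 w.1)%:E <= fitzpatrick p T z)%E.
Proof. by move=> Tw; apply: ereal_sup_ubound; exists w. Qed.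

(** The term of [w] in the supremum equals [pi_ p z] minus [pairing (z.2 - w.2) w.1 z.1], which is
    nonnegative by monotonicity and vanishes at [w = z]. *)
Lemma fitzpatrick_gra T z : monotone T -> gra T z ->
  fitzpatrick p T z = pi_ p z.
Proof.
move=> Tmono Tz; apply/eqP; rewrite eq_le; apply/andP; split.
  apply: ge_ereal_sup => _ [w Tw <-]; rewrite lee_fin.
  have := Tmono z w Tz Tw; have := pairing_chasles w.2 w.1 z.1 w.1.
  by rewrite pairingxx pairingB (pairing_chasles z.2 p w.1 z.1); lra.
by have := le_fitzpatrick T z z Tz; rewrite pairingxx subr0.
Qed.

Lemma le_pi_fitzpatrick T : maximal_monotone T ->
  le_pi p (fitzpatrick p T) = gra T.
Proof.
move=> Tmax; apply/seteqP; split=> z; last first.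
  by move=> Tz; rewrite /le_pi /= fitzpatrick_gra //; case: Tmax.
move=> zT; apply: maximal_monotone_mem => // w Tw.
have := le_trans (le_fitzpatrick T z w Tw) zT; rewrite lee_fin.
have := pairing_chasles w.2 w.1 z.1 w.1.
by rewrite pairingxx pairingB (pairing_chasles z.2 p w.1 z.1); lra.
Qed.

(** A point of the graph gives a real lower bound everywhere and a finite value at itself. *)
Lemma fitzpatrick_proper T : maximal_monotone T ->
  Defs.proper (fitzpatrick p T).
Proof.
move=> Tmax; have [w Tw] := maximal_monotone_nonempty T Tmax; split=> [z zNy|].
  by have := le_fitzpatrick T z w Tw; rewrite zNy.
by exists w; rewrite fitzpatrick_gra //; case: Tmax.
Qed.

Lemma fitzpatrick_lsc T : lsc (fitzpatrick p T).
Proof.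
(* The epigraph of a supremum is the intersection of the epigraphs of its terms, each closed by
   continuity of the pairing in either argument. *)
rewrite /lsc; have -> : epigraph (fitzpatrick p T) = \bigcap_(w in gra T)
    [set v | pairing v.1.2 p w.1 - pairing w.2 v.1.1 w.1 - v.2 <= 0].
  apply/seteqP; split=> v; rewrite /epigraph /=.
    move=> vT w Tw /=; rewrite subr_le0 -lee_fin.
    exact: le_trans (le_fitzpatrick T v.1 w Tw) vT.
  move=> vT; apply: ge_ereal_sup => _ [w Tw <-].
  by rewrite lee_fin -subr_le0; exact: vT.
apply: closed_bigI => w _.
apply: (preimage_closed (D := [set r : R | r <= 0])) => [v _|];
  last exact: closed_le.
apply: (@cvgB _ R^o); last exact: cvg_snd.
have fst_v : {for v, continuous (fst : (X * ldual X) * R -> X * ldual X)}.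
  exact: cvg_fst.
apply: (@cvgB _ R^o).
- apply: (continuous_comp (f := fun u : (X * ldual X) * R => u.1.2)
    (g := fun f : ldual X => pairing f p w.1 : R)).
    by apply: (continuous_comp (g := snd)); [|exact: cvg_snd].
  exact: pairing_continuous.
- apply: (continuous_comp (f := fun u : (X * ldual X) * R => u.1.1)
    (g := fun x : X => pairing w.2 x w.1 : R)).
    by apply: (continuous_comp (g := fst)); [|exact: cvg_fst].
  exact: pairing_continuousl.
Qed.

Lemma fitzpatrick_convex T : Fl_property p ([set: X] `*` Range (gra T)) ->
  convex (fitzpatrick p T).
Proof.
move=> TFl x y f g l l01; apply: ge_ereal_sup => _ [w Tw <-].
have le_scale (k : R) z : 0 <= k ->
    ((k * (pairing z.2 p w.1 - pairing w.2 z.1 w.1))%:E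
     <= k%:E * fitzpatrick p T z)%E.
  by move=> k0; rewrite EFinM lee_wpmul2l ?lee_fin //; exact: le_fitzpatrick.
have /andP[l0 l1] := l01.
have := leeD (le_scale (1 - l) (x, f) _) (le_scale l (y, g) l0).
rewrite subr_ge0 => /(_ l1); apply: le_trans; rewrite -EFinD lee_fin.
rewrite -[leLHS]/(pairing ((1 - l) *: f + l *: g) p w.1
  - pairing w.2 (geopt x y l) w.1)
  [(x, f).1]/= [(x, f).2]/= [(y, g).1]/= [(y, g).2]/=.
have Rw : Range (gra T) w.2 by exists w.
have DX u : Dom ([set: X] `*` Range (gra T)) u by exists (u, w.2).
have RR : Range ([set: X] `*` Range (gra T)) w.2 by exists (p, w.2).
have := TFl l w.2 x y l01 RR (DX x) (DX y).
(* In this form the term of [w] depends on the point [u] only through [+ pairing w.2 p u], to which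
   the F_l-property applies; in the functional it is linear. *)
have E u : pairing w.2 u w.1 = pairing w.2 p w.1 - pairing w.2 p u.
  by rewrite (pairing_chasles w.2 p u w.1); ring.
by rewrite pairing_conv (E x) (E y) (E (geopt x y l)); lra.
Qed.

Lemma fitzpatrick_conj T : maximal_monotone T ->
  fitzpatrick p T =
  fenchel_conj p (fun z => fitzpatrick p T z
    + iota_ (le_pi p (fitzpatrick p T)) z)%E \o r_swap.
Proof.
move=> Tmax; have [Tmono _] := Tmax; rewrite le_pi_fitzpatrick //.
apply/funext => z; rewrite /fenchel_conj /=.
have E w : gra T w -> ((pairing z.2 p w.1 + pairing w.2 p z.1)%:E
    - (fitzpatrick p T w + iota_ (gra T) w))%E
    = (pairing z.2 p w.1 - pairing w.2 z.1 w.1)%:E.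
  move=> Tw; rewrite /iota_ mem_set // adde0 fitzpatrick_gra // -EFinB.
  by congr EFin; rewrite (pairing_chasles w.2 p z.1 w.1); ring.
apply/eqP; rewrite eq_le; apply/andP; split; apply: ge_ereal_sup.
  by move=> _ [w Tw <-]; apply: ereal_sup_ubound; exists w => //; exact: E.
move=> _ [w _ <-]; have [Tw|nTw] := pselect (gra T w).
  by rewrite E //; exact: le_fitzpatrick.
(* Off the graph the term is -oo: the indicator makes the sum +oo, provided that the transform is
   not -oo there, since -oo would absorb +oo. *)
have [/(_ w) wNy _] := fitzpatrick_proper T Tmax.
by rewrite /iota_ memNset // addey ?addeNy ?leNye //; exact/eqP.
Qed.

Lemma fitzpatrick_Gamma_dual T : maximal_monotone T ->
  Fl_property p ([set: X] `*` Range (gra T)) -> Gamma_dual p (fitzpatrick p T).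
Proof.
move=> Tmax TFl; split; last exact: fitzpatrick_conj.
by split; [exact: fitzpatrick_proper|exact: fitzpatrick_lsc|
  exact: fitzpatrick_convex].
Qed.

End Fitzpatrick.

Theorem proposition5p12 (R : realType) (X : metricType R) (p : X) :
  hadamard X ->
  (forall T : X -> set (ldual X),
     maximal_monotone T ->
     Fl_property p ([set: X] `*` Range (gra T)) ->
     Gamma_dual p (fitzpatrick p T))
  /\
  (flat X -> forall T : X -> set (ldual X),
     maximal_monotone T ->
     Gamma_dual p (fitzpatrick p T)).
Proof.
move=> _; split=> [T|X_flat T Tmax]; first exact: fitzpatrick_Gamma_dual.
(* In a flat space the F_l-inequality holds with equality. *)
apply: fitzpatrick_Gamma_dual => // l f x y l01 _ _ _.
by rewrite flat_pairing_geopt.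
Qed.
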